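(* Let $\mathbb A$ be a finite algebra with universe $A$. Then $\mathbb A$ has the exponentially generated powers (EGP) property if and only if $\langle D_{A,m}\rangle_{\mathbb A}\neq A^{2m}$ for every integer $m\ge |A|$.
   Context: A finite algebra $\mathbb A$ is a finite nonempty set $A$ together with a (possibly infinite) family of finitary operations $f\colon A^{s}\to A$, all of arity $s\ge 1$. The power $\mathbb A^{n}$ ($n\ge 1$) has universe $A^n$, with operations acting coordinatewise. For $X\subseteq A^{n}$, $\langle X\rangle_{\mathbb A}$ denotes the subalgebra of $\mathbb A^n$ generated by $X$, i.e. the smallest subset of $A^n$ containing $X$ and closed under all (coordinatewise) operations; $\mathbb A^n$ is generated by $X$ if $\langle X\rangle_{\mathbb A}=A^n$. EGP: $\mathbb A$ has the exponentially generated powers (EGP) property if there exist real numbers $b>1$ and $C>0$ such that for every $n\ge 1$ the power $\mathbb A^{n}$ cannot be generated by less than $C b^{n}$ tuples. For an integer $m$, $D_{A,m}=\{(a_1,\ldots,a_{2m})\in A^{2m}\mid (a_1=a_2)\vee(a_3=a_4)\vee\dots\vee(a_{2m-1}=a_{2m})\}$. *)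

(* Defs.v *)
From HB Require Import structures.
From mathcomp Require Import all_boot all_order all_algebra.
From mathcomp Require Import boolp classical_sets reals.

Set Implicit Arguments.
Unset Strict Implicit.
Unset Printing Implicit Defensive.

Import Order.TTheory GRing.Theory Num.Theory.

Local Open Scope classical_set_scope.

Record finite_algebra := FiniteAlgebra {
  carrier :> finType;
  carrier_gt0 : 0 < #|carrier|;
  symbol : Type;
  arity : symbol -> nat;
  arity_gt0 : forall f : symbol, 0 < arity f;
  interp : forall f : symbol, {ffun 'I_(arity f) -> carrier} -> carrier
}.

Section Powers.
Variables (A : finite_algebra) (n : nat).

Definition power := {ffun 'I_n -> A}.

Definition power_interp (f : symbol A) (t : 'I_(arity f) -> power) : power :=
  [ffun k => interp [ffun j => t j k]].

Definition op_closed (S : set power) : Prop :=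
  forall (f : symbol A) (t : 'I_(arity f) -> power),
    (forall j, S (t j)) -> S (power_interp t).

Definition generated (X : set power) : set power := smallest op_closed X.

End Powers.

Local Open Scope ring_scope.

Definition EGP (R : realType) (A : finite_algebra) : Prop :=
  exists b C : R, [/\ 1 < b, 0 < C &
    forall n : nat, (1 <= n)%N -> forall X : {set power A n},
      generated [set` X] = setT -> C * b ^+ n <= #|X|%:R].

Lemma fst_index_subproof (m : nat) (i : 'I_m) : (2 * i < 2 * m)%N.
Proof. by rewrite ltn_pmul2l. Qed.

Lemma snd_index_subproof (m : nat) (i : 'I_m) : ((2 * i).+1 < 2 * m)%N.
Proof. by rewrite !mul2n ltn_Sdouble ltn_ord. Qed.

(* Coordinates are numbered from 0: the pair (a_(2i-1), a_(2i)) of the usual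
   1-based numbering is (a (fst_index (i-1)), a (snd_index (i-1))). *)
Definition fst_index (m : nat) (i : 'I_m) : 'I_(2 * m) :=
  Ordinal (fst_index_subproof i).
Definition snd_index (m : nat) (i : 'I_m) : 'I_(2 * m) :=
  Ordinal (snd_index_subproof i).

Definition Dset (A : finite_algebra) (m : nat) : set (power A (2 * m)) :=
  [set a | exists i : 'I_m, a (fst_index i) = a (snd_index i)].
Arguments Dset : clear implicits.

(* Main.v *)
(* Generation is preserved by pulling tuples back along a map of coordinates.
   If D_m generates A^(2m) for some m >= |A|, then for N >= 2m every tuple of
   A^N is generated by tuples with two equal adjacent entries; pulling back
   along monotone maps, A^n is generated by the tuples constant on 2m intervals
   of coordinates, which are polynomially many in n.
   Conversely, let X generate A^(n0 + |A|) with |X| 2^|A| < 2^n0. Then some set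
   I of coordinates among the first n0 is not of the form {i | x_i in V} with
   x in X, so every x in X takes equal values at some i in I and j not in I.
   Take w outside the subalgebra generated by D_m with m so large that some
   (a, b) occurs n0^2 times among the pairs of w. Map these pairs onto the pairs
   (i, j) with i in I and j not in I, and the remaining entries to the last |A|
   coordinates, one for each letter: w is then the pull-back of a tuple
   generated by X while X is pulled back into D_m, a contradiction. *)
Require Import Defs.
From mathcomp Require Import all_boot all_order all_algebra.
From mathcomp Require Import boolp classical_sets reals.
From mathcomp Require Import zify ring.

Set Implicit Arguments.
Unset Strict Implicit.
Unset Printing Implicit Defensive.

Import Order.TTheory GRing.Theory Num.Theory.

Local Open Scope classical_set_scope.

Section Generation.
Variable A : finite_algebra.

(** * Pull-backs and generated subalgebras *)

Definition pull n N (s : 'I_N -> 'I_n) (x : power A n) : power A N :=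
  [ffun k => x (s k)].

Lemma pull_pull n N M (s : 'I_N -> 'I_n) (t : 'I_M -> 'I_N) (x : power A n) :
  pull t (pull s x) = pull (s \o t) x.
Proof. by apply/ffunP => k; rewrite !ffunE. Qed.

Lemma generated_op_closed n (X : set (power A n)) : op_closed (generated X).
Proof.
move=> f t Xt S [Scl XS]; by apply: (Scl) => j; exact: Xt.
Qed.

Lemma sub_generated n (X : set (power A n)) : X `<=` generated X.
Proof. by move=> x Xx S [_]; apply. Qed.

Lemma generated_sub n (X Y : set (power A n)) :
  X `<=` generated Y -> generated X `<=` generated Y.
Proof. by move=> XY x; apply; split=> //; exact: generated_op_closed. Qed.

(** Operations act coordinatewise, so the tuples whose pull-back lies in [generated Y] form a closed
    set. *)
Lemma generated_pull n N (s : 'I_N -> 'I_n)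
    (X : set (power A n)) (Y : set (power A N)) (x : power A n) :
  (forall y, X y -> generated Y (pull s y)) ->
  generated X x -> generated Y (pull s x).
Proof.
move=> XY; apply: (_ : generated X `<=` [set y | generated Y (pull s y)]).
apply: smallest_sub; last exact: XY.
move=> f t Yt /=.
have -> : pull s (power_interp t) = power_interp (fun j => pull s (t j)).
  apply/ffunP => k; rewrite !ffunE; congr interp.
  by apply/ffunP => j; rewrite !ffunE.
exact: generated_op_closed.
Qed.

(* Every column outside the image of [i] is a copy of one inside, so the terms
   producing [pull i w] also produce [w]. *)
Lemma generated_extend M N (i : 'I_M -> 'I_N) (w : power A N)
    (Y : set (power A M)) :
  injective i -> (forall k, exists k', w (i k') = w k) ->
  generated Y (pull i w) -> generated [set y | Y (pull i y)] w.
Proof.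
move=> i_inj cover Yw.
have [s [si ws]] : exists s : 'I_N -> 'I_M,
    cancel i s /\ forall k, w (i (s k)) = w k.
  have /choice [s sP] : forall k, exists k',
      (forall l, i l = k -> k' = l) /\ w (i k') = w k.
    move=> k; case: (pselect (exists l, i l = k)) => [[l <-]|nk].
      by exists l; split=> // l' /i_inj.
    have [k' wk'] := cover k; exists k'; split=> // l il.
    by case: nk; exists l.
  by exists s; split=> k; [apply: (sP _).1|apply: (sP k).2].
have -> : w = pull s (pull i w) by apply/ffunP => k; rewrite !ffunE ws.
apply: generated_pull Yw => y Yy; apply: sub_generated => /=.
by rewrite pull_pull; congr Y: Yy; apply/ffunP => k; rewrite ffunE /= si.
Qed.

(** * Passing from [m] pairs to more pairs *)

Lemma half_index_subproof m (k : 'I_(2 * m)) : k./2 < m.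
Proof. by have := ltn_ord k; lia. Qed.

Definition half_index m (k : 'I_(2 * m)) : 'I_m :=
  Ordinal (half_index_subproof k).

Definition pair_index m (b : bool) : 'I_m -> 'I_(2 * m) :=
  if b then @snd_index m else @fst_index m.

Lemma pair_indexE m b (l : 'I_m) : pair_index b l = 2 * l + b :> nat.
Proof. by case: b => /=; lia. Qed.

Lemma half_indexK m (k : 'I_(2 * m)) : pair_index (odd k) (half_index k) = k.
Proof. by apply: val_inj; rewrite /= pair_indexE /=; lia. Qed.

Lemma half_pair_index m b (l : 'I_m) : half_index (pair_index b l) = l.
Proof. by apply: val_inj; rewrite /= pair_indexE /=; case: b; lia. Qed.

Lemma odd_pair_index m b (l : 'I_m) : odd (pair_index b l) = b.
Proof. by rewrite pair_indexE; case: b; lia. Qed.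

Lemma generated_Dset_succ m : #|A| <= m ->
  generated (Dset A m) = setT -> generated (Dset A m.+1) = setT.
Proof.
move=> leAm Dm; rewrite -subTset => w _.
have /choice [g gP] : forall a : A, exists l : 'I_m.+1,
    forall k, w k = a -> exists b, w (pair_index b l) = a.
  move=> a; case: (pselect (exists k, w k = a)) => [[k wk]|nk].
    exists (half_index k) => _ _; exists (odd k).
    by rewrite half_indexK.
  by exists ord0 => k wk; case: nk; exists k.
(* Fewer than [m.+1] pairs suffice to carry all the letters of [w]. *)
have [l0 l0g] : exists l0, l0 \notin codom g.
  apply/existsP; rewrite -negb_forall; apply/negP => /forallP cg.
  have : #|'I_m.+1| <= #|codom g|.
    by apply: subset_leq_card; apply/fintype.subsetP => l _; exact: cg.
  rewrite card_ord => /leq_trans /(_ (card_size _)).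
  by rewrite size_codom ltnNge leAm.
pose i (k : 'I_(2 * m)) := pair_index (odd k) (lift l0 (half_index k)).
have iE b l : i (pair_index b l) = pair_index b (lift l0 l).
  by rewrite /i odd_pair_index half_pair_index.
have i_inj : injective i.
  move=> k k' /(congr1 (fun k : 'I_(_ * _) => (odd k, half_index k))).
  rewrite !odd_pair_index !half_pair_index => e.
  have ok := congr1 fst e; have /lift_inj hk := congr1 snd e.
  by rewrite -[k]half_indexK -[k']half_indexK [odd k]ok [half_index k]hk.
have cover k : exists k', w (i k') = w k.
  have [b <-] := gP (w k) k erefl.
  case: (unliftP l0 (g (w k))) => [l ->|gl0].
    by exists (pair_index b l); rewrite iE.
  by rewrite -gl0 codom_f in l0g.
have : generated (Dset A m) (pull i w) by rewrite Dm.
move=> /(generated_extend i_inj cover); apply: generated_sub => y [l].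
rewrite !ffunE => yl; apply: sub_generated; exists (lift l0 l).
by have := iE false l; have := iE true l; rewrite /= => <- <-.
Qed.

Lemma generated_Dset_ge m m' : #|A| <= m <= m' ->
  generated (Dset A m) = setT -> generated (Dset A m') = setT.
Proof.
move=> /andP[Am]; elim: m' => [|m' IH].
  by rewrite leqn0 => /eqP m0; subst m.
rewrite leq_eqVlt => /orP[/eqP <- //|]; rewrite ltnS => mm' Dm.
by apply: generated_Dset_succ (IH mm' Dm); exact: leq_trans mm'.
Qed.

(** * Tuples with two equal adjacent entries *)

Definition adjacent_equal N : set (power A N) :=
  [set y | exists i j : 'I_N, j = i.+1 :> nat /\ y i = y j].

Lemma generated_adjacent_even m :
  generated (Dset A m) = setT -> generated (@adjacent_equal (2 * m)) = setT.
Proof.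
rewrite -!subTset => Dm w /Dm; apply: generated_sub => y [l yl].
by apply: sub_generated; exists (fst_index l), (snd_index l).
Qed.

Lemma generated_adjacent_odd m : #|A| <= m ->
  generated (Dset A m) = setT -> generated (@adjacent_equal (2 * m).+1) = setT.
Proof.
move=> leAm Dm; rewrite -subTset => w _.
have even_lt (l : 'I_m.+1) : 2 * l < (2 * m).+1 by have := ltn_ord l; lia.
pose ev l := Ordinal (even_lt l).
(* The [m.+1] even positions cannot carry distinct letters: one of them can be
   left out, and the others are matched into adjacent pairs. *)
have [l0 [l1 [l01 wl]]] : exists l0 l1, l0 <> l1 /\ w (ev l0) = w (ev l1).
  apply: contrapT => H.
  have inj : injective (w \o ev).
    move=> l l' /= e; apply: contrapT => ne; apply: H.
    by exists l, l'.
  by have := leq_card _ inj; rewrite card_ord; lia.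
have cover k : exists k', w (lift (ev l0) k') = w k.
  case: (unliftP (ev l0) k) => [l ->|->]; first by exists l.
  case: (unliftP (ev l0) (ev l1)) => [l e|e]; first by exists l; rewrite wl e.
  by case: l01; apply: val_inj; have := congr1 val e => /=; lia.
have : generated (Dset A m) (pull (lift (ev l0)) w) by rewrite Dm.
move=> /(generated_extend (@lift_inj _ _) cover).
apply: generated_sub => y [l]; rewrite !ffunE => yl; apply: sub_generated.
(* The omitted position is even, so it never separates the two positions of a pair. *)
exists (lift (ev l0) (fst_index l)), (lift (ev l0) (snd_index l)).
by split=> //=; rewrite /bump; lia.
Qed.

Lemma generated_adjacent m N : #|A| <= m -> 2 * m <= N ->
  generated (Dset A m) = setT -> generated (@adjacent_equal N) = setT.
Proof.
move=> Am mN Dm; have mN2 : #|A| <= m <= N./2 by lia.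
have DN := generated_Dset_ge mN2 Dm.
have [oN|eN] := boolP (odd N).
  have -> : N = (2 * N./2).+1 by lia.
  by apply: generated_adjacent_odd => //; lia.
have -> : N = 2 * N./2 by lia.
exact: generated_adjacent_even.
Qed.

(** * Polynomially many generators from monotone maps *)

Definition monotone_maps n N : {set {ffun 'I_n -> 'I_N}} :=
  [set s : {ffun 'I_n -> 'I_N} |
    [forall i : 'I_n, forall j : 'I_n, (i <= j) ==> (s i <= s j)]]%SET.

Lemma monotone_mapsP n N (s : {ffun 'I_n -> 'I_N}) :
  reflect (forall i j : 'I_n, i <= j -> s i <= s j) (s \in monotone_maps n N).
Proof.
rewrite inE; apply: (iffP idP) => [/forallP sm i j ij|sm].
  by have /forallP/(_ j)/implyP/(_ ij) := sm i.
by apply/forallP => i; apply/forallP => j; apply/implyP; exact: sm.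
Qed.

(** A monotone map is determined by its jumps: for each [l < N], the first argument whose value
    exceeds [l], or [n] if there is none. *)
Lemma card_monotone_maps n N : #|monotone_maps n N| <= n.+1 ^ N.
Proof.
have jumpP (s : {ffun 'I_n -> 'I_N}) (l : 'I_N) :
    find (fun i : 'I_n => l < s i) (enum 'I_n) < n.+1.
  by rewrite ltnS (leq_trans (find_size _ _)) // size_enum_ord.
pose jump s := [ffun l => Ordinal (jumpP s l)].
have jumpE s (i : 'I_n) (l : 'I_N) :
    s \in monotone_maps n N -> (jump s l <= i) = (l < s i).
  move=> /monotone_mapsP sm; rewrite ffunE /=.
  apply/idP/idP => [le|lt].
    have hs : has (fun i : 'I_n => l < s i) (enum 'I_n).
      rewrite has_find size_enum_ord; exact: leq_ltn_trans le (ltn_ord i).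
    apply: leq_trans (nth_find i hs) (sm _ i _).
    by rewrite nth_enum_ord // (leq_ltn_trans le).
  rewrite leqNgt; apply/negP => /(before_find i).
  by rewrite nth_ord_enum lt.
have jump_inj : {in monotone_maps n N &, injective jump}.
  move=> s s' sm sm' e; apply/ffunP => i; apply: val_inj.
  have e' (l : 'I_N) : (l < s i) = (l < s' i) by rewrite -!jumpE // e.
  by have := e' (s i); have := e' (s' i); rewrite !ltnn /=; case: ltngtP.
rewrite -(card_in_imset jump_inj); apply: leq_trans (max_card _) _.
by rewrite card_ffun !card_ord.
Qed.

Definition monotone_pulls n N : {set power A n} :=
  [set pull p.1 p.2 | p : {ffun 'I_n -> 'I_N} * power A N in
    finset.setX (monotone_maps n N) [set: power A N]]%SET.

Lemma card_monotone_pulls n N :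
  #|monotone_pulls n N| <= n.+1 ^ N * #|A| ^ N.
Proof.
apply: leq_trans (leq_imset_card _ _) _.
rewrite cardsX cardsT card_ffun card_ord leq_mul2r card_monotone_maps.
exact: orbT.
Qed.

Lemma mem_monotone_pulls n N (s : {ffun 'I_n -> 'I_N}) (w : power A N) :
  s \in monotone_maps n N -> pull s w \in monotone_pulls n N.
Proof.
by move=> sm; apply/imsetP; exists (s, w) => //; rewrite inE sm inE.
Qed.

(** Two neighbouring intervals that carry the same letter merge into one. *)
Lemma pull_adjacent n N (s : {ffun 'I_n -> 'I_N.+1}) (y : power A N.+1) :
  s \in monotone_maps n N.+1 -> adjacent_equal y ->
  pull s y \in monotone_pulls n N.
Proof.
move=> /monotone_mapsP sm [i [j [ji yij]]].
(* Values above [i] drop by one, so [j = i.+1] is identified with [i]. *)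
have mergeP (k : 'I_N.+1) : k - (i < k) < N.
  by have := ltn_ord k; have := ltn_ord j; lia.
pose merge k : 'I_N := Ordinal (mergeP k).
have -> : pull s y = pull [ffun k => merge (s k)] (pull (lift j) y).
  apply/ffunP => k; rewrite !ffunE.
  have [->|nj] := eqVneq (s k) j.
    rewrite -yij; congr (y _); apply: val_inj; rewrite /= /bump /=; lia.
  have : s k <> j :> nat by move/val_inj/eqP; apply/negP.
  by move=> skj; congr (y _); apply: val_inj; rewrite /= /bump /=; lia.
apply: mem_monotone_pulls; apply/monotone_mapsP => k l kl; rewrite !ffunE /=.
by have := sm _ _ kl; lia.
Qed.

Lemma generated_monotone_pulls m n : #|A| <= m -> 2 * m <= n ->
  generated (Dset A m) = setT ->
  generated [set` monotone_pulls n (2 * m)] = setT.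
Proof.
move=> Am mn Dm.
(* The number of intervals is lowered one at a time from [n], where the identity map yields every
   tuple, down to [2 * m]. *)
have step N : 2 * m <= N <= n ->
    [set` monotone_pulls n N] `<=` generated [set` monotone_pulls n (2 * m)].
  elim: N => [|N IH].
    by rewrite leqn0 => /andP[/eqP -> _]; exact: sub_generated.
  rewrite leq_eqVlt => /andP[/orP[/eqP <- _|mN Nn]]; first exact: sub_generated.
  move=> _ /= /imsetP[[s w] /finset.setXP[/= sm _] ->].
  have : generated (@adjacent_equal N.+1) w.
    by rewrite (@generated_adjacent m) // ltnW.
  apply: generated_pull => y yadj; apply: IH; first by lia.
  exact: pull_adjacent.
rewrite -subTset => x _; apply: (step n); first by lia.
have -> : x = pull [ffun k => k] x by apply/ffunP => k; rewrite !ffunE.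
by apply: mem_monotone_pulls; apply/monotone_mapsP => i j; rewrite !ffunE.
Qed.

(** * Lower bound on the size of generating sets *)

(** All arities are positive, so the empty set is closed under the operations. *)
Lemma generated_card_gt0 n (X : {set power A n}) :
  generated [set` X] = setT -> 0 < #|X|.
Proof.
move=> XT; rewrite lt0n cards_eq0; apply/eqP => X0.
have [a _] : exists a : A, true.
  by have /card_gt0P[a _] := carrier_gt0 A; exists a.
have : generated [set` X] [ffun=> a] by rewrite XT.
move/(_ set0); apply; split; last by move=> x; rewrite /= X0 inE.
by move=> f t /(_ (Ordinal (arity_gt0 f))).
Qed.

Lemma ltn_card_fibre (T U : finType) (g : T -> U) c :
  #|U| * c < #|T| -> exists u, c < #|[set t | g t == u]%SET|.
Proof.
move=> lt; apply/existsP; rewrite -[X in is_true X]negbK negb_exists.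
apply/negP => /forallP le; move: lt; rewrite ltnNge => /negP; apply.
rewrite -sum1_card (partition_big g predT) //= -sum_nat_const.
apply: leq_sum => u _; have := le u; rewrite -leqNgt; apply: leq_trans.
by rewrite -sum1_card; apply: eq_leq; apply: eq_bigl => t; rewrite inE.
Qed.

Lemma card_set_type (T : finType) : #|{set T}| = 2 ^ #|T|.
Proof. by rewrite -[LHS]cardsT -powersetT card_powerset cardsT. Qed.

Lemma exists_unsplit_set n0 n (i : 'I_n0 -> 'I_n) (X : {set power A n}) :
  #|X| * 2 ^ #|A| < 2 ^ n0 ->
  exists I : {set 'I_n0}, forall x, x \in X ->
    exists j k, [/\ j \in I, k \notin I & x (i j) = x (i k)].
Proof.
move=> lt.
pose B := [set [set j | p.1 (i j) \in p.2]%SET | p : power A n * {set A} in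
  finset.setX X [set: {set A}]]%SET.
have [I IB] : exists I, I \notin B.
  apply/existsP; rewrite -negb_forall; apply/negP => /forallP all.
  have : #|{set 'I_n0}| <= #|B|.
    by apply: subset_leq_card; apply/fintype.subsetP => I _; exact: all.
  have := leq_imset_card (fun p : power A n * {set A} =>
    [set j | p.1 (i j) \in p.2]%SET) (mem (finset.setX X [set: {set A}]%SET)).
  rewrite -/B cardsX cardsT !card_set_type card_ord => leB /leq_trans/(_ leB).
  by rewrite leqNgt lt.
(* If [x] shared no value between [I] and its complement, then [I] would be the preimage of the set
   of values of [x] on [I]. *)
exists I => x xX; apply: contrapT => H; move/negP: IB; apply.
apply/imsetP; exists (x, [set x (i j) | j in I]%SET); first by rewrite !inE xX.
apply/finset.setP => k; rewrite inE /=; apply/idP/imsetP => [kI|[j jI e]].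
  by exists k.
by apply: contrapT => /negP kI; apply: H; exists j, k.
Qed.

Lemma card_generators n0 (X : {set power A (n0 + #|A|)}) :
  (forall m, #|A| <= m -> generated (Dset A m) <> setT) ->
  generated [set` X] = setT -> 2 ^ n0 <= #|X| * 2 ^ #|A|.
Proof.
move=> nD XT; rewrite leqNgt; apply/negP => lt.
have [I IP] := exists_unsplit_set (@lshift n0 #|A|) lt.
have A0 := carrier_gt0 A.
(* The first summand plus a positive one forces some pair of letters to occur more than [n0 * n0]
   times; the second also ensures [#|A| <= m]. *)
pose m := #|{: A * A}| * (n0 * n0) + #|A|.
have [w wD] : exists w, ~ generated (Dset A m) w.
  apply: contrapT => H; apply: (nD m); first exact: leq_addl.
  by rewrite -subTset => w _; apply: contrapT => ww; apply: H; exists w.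
pose g l := (w (fst_index l), w (snd_index l)).
have [[a b] abP] : exists p, n0 * n0 < #|[set l : 'I_m | g l == p]%SET|.
  by apply: ltn_card_fibre; rewrite card_ord -[ltnLHS]addn0 ltn_add2l.
set F := [set l | _]%SET in abP.
pose IJ := enum (finset.setX I (~: I)%SET).
have sizeIJ : size IJ <= #|F|.
  by rewrite -cardE (leq_trans (max_card _)) // card_prod !card_ord ltnW.
(* The pairs in [F] are matched in order with the list [IJ]; those left over get the default [None]
   and are treated like pairs outside [F]. *)
pose h l := if l \in F then nth None (map Some IJ) (index l (enum F)) else None.
have hP l i j : h l = Some (i, j) -> [/\ g l = (a, b), i \in I & j \notin I].
  rewrite /h; case: ifP => //; rewrite inE => /eqP -> e.
  have [lt'|le] := ltnP (index l (enum F)) (size IJ); last first.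
    by rewrite nth_default ?size_map in e.
  rewrite (nth_map (i, j)) // in e; case: e => e.
  have := mem_nth (i, j) lt'; rewrite e mem_enum !inE /= => /andP[].
  by [].
have hsurj i j : i \in I -> j \notin I -> exists l, h l = Some (i, j).
  move=> iI jI; have ijIJ : (i, j) \in IJ by rewrite mem_enum !inE iI.
  have lt' : index (i, j) IJ < size (enum F).
    by rewrite -cardE (leq_trans _ sizeIJ) // index_mem.
  have [l0 _] : exists l0, l0 \in F by apply/card_gt0P; rewrite cardE; lia.
  exists (nth l0 (enum F) (index (i, j) IJ)).
  rewrite /h -mem_enum mem_nth // index_uniq ?enum_uniq //.
  by rewrite (nth_map (i, j)) ?index_mem // nth_index.
pose s (k : 'I_(2 * m)) := if h (half_index k) is Some (i, j)
  then lshift #|A| (if odd k then j else i) else rshift n0 (enum_rank (w k)).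
pose x : power A (n0 + #|A|) := [ffun k => match split k with
  | inl i => if i \in I then a else b | inr r => enum_val r end].
apply: wD; have -> : w = pull s x.
  apply/ffunP => k; rewrite !ffunE /s.
  case e: (h (half_index k)) => [[i j]|].
    have [[ga gb] iI jI] := hP _ _ _ e.
    rewrite -[k in LHS]half_indexK; case: (odd k) => /=.
      by rewrite gb (unsplitK (inl j)) (negbTE jI).
    by rewrite ga (unsplitK (inl i)) iI.
  by rewrite (unsplitK (inr _)) enum_rankK.
apply: (@generated_pull _ _ _ [set` X]); last by rewrite XT.
move=> y /IP [i [j [iI jI yij]]]; apply: sub_generated.
have [l hl] := hsurj i j iI jI; exists l; rewrite !ffunE /s.
rewrite -[fst_index l]/(pair_index false l) -[snd_index l]/(pair_index true l).
by rewrite !half_pair_index !odd_pair_index hl.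
Qed.

(** One factor [2 ^ #|A|] comes from [card_generators], the other from setting aside [#|A|] of the
    [n] coordinates. For [n < #|A|] it suffices that [X] is nonempty. *)
Lemma card_generators_exp n (X : {set power A n}) :
  (forall m, #|A| <= m -> generated (Dset A m) <> setT) ->
  generated [set` X] = setT -> 2 ^ n <= #|X| * 2 ^ (2 * #|A|).
Proof.
move=> nD XT; have [le|lt] := leqP #|A| n.
  move: X XT; rewrite -(subnK le) => X XT.
  have := card_generators nD XT.
  by rewrite expnD mul2n -addnn expnD mulnA leq_pmul2r ?expn_gt0.
apply: leq_trans (leq_pmull _ (generated_card_gt0 XT)).
by rewrite leq_exp2l //; lia.
Qed.

End Generation.

(** * Exponential against polynomial growth, and the equivalence *)

Local Open Scope ring_scope.

(** For [n = N.+1 * q], Bernoulli's inequality bounds [b ^+ n] below by a multiple of [q ^ N.+1],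
    while [n.+1 <= N.+2 * q] keeps the left side of degree [N] in [q]. *)
Lemma exp_gt_poly (R : realType) (b C c : R) (N : nat) :
  1 < b -> 0 < C -> 0 <= c ->
  exists2 n, (N < n)%N & c * n.+1%:R ^+ N < C * b ^+ n.
Proof.
move=> b1 C0 c0; pose e := b - 1.
have e0 : 0 < e by rewrite subr_gt0.
have bern (q : nat) : q%:R * e <= b ^+ q.
  elim: q => [|q IH]; first by rewrite mul0r expr0.
  have bq : 1 <= b ^+ q by rewrite exprn_ege1 // ltW.
  have -> : b ^+ q.+1 = b ^+ q + e * b ^+ q by rewrite exprS /e; ring.
  by rewrite -natr1 mulrDl mul1r lerD // ler_peMr // ltW.
have D0 : 0 < C * e ^+ N.+1 by rewrite mulr_gt0 ?exprn_gt0.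
(* The threshold for [q] once the common factor [q ^ N] is cancelled. *)
pose K := c * (N.+2%:R) ^+ N / (C * e ^+ N.+1).
pose q := (Num.truncn K).+1.
have Kq : K < q%:R by rewrite truncnS_gt.
exists (N.+1 * q)%N; first by rewrite /q; lia.
have q0 : 0 < q%:R :> R by rewrite ltr0n.
apply: (@le_lt_trans _ _ (c * (N.+2%:R * q%:R) ^+ N)).
  rewrite ler_wpM2l // lerXn2r ?nnegrE ?mulr_ge0 //.
  by rewrite -natrM ler_nat /q; lia.
apply: (@lt_le_trans _ _ (C * (q%:R * e) ^+ N.+1)); last first.
  have be0 : 0 <= q%:R * e by rewrite mulr_ge0 // ltW.
  rewrite ler_pM2l // mulnC exprM lerXn2r ?nnegrE ?bern //.
  exact: le_trans be0 (bern q).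
move: Kq; rewrite ltr_pdivrMr // => Kq.
have -> : c * (N.+2%:R * q%:R) ^+ N = q%:R ^+ N * (c * N.+2%:R ^+ N).
  by rewrite exprMn; ring.
have -> : C * (q%:R * e) ^+ N.+1 = q%:R ^+ N * (q%:R * (C * e ^+ N.+1)).
  by rewrite exprMn (exprS q%:R); ring.
by rewrite ltr_pM2l // exprn_gt0.
Qed.

Theorem theorem3 (R : realType) (A : finite_algebra) :
  EGP R A <->
  (forall m : nat, (#|A| <= m)%N ->
     generated (Dset A m) <> [set: power A (2 * m)]%classic).
Proof.
split=> [[b [C [b1 C0 lb]]] m Am Dm|nD].
  (* Coefficient and degree are those of the bound on [#|monotone_pulls n (2 * m)|]. *)
  have [n mn] :=
    @exp_gt_poly R b C (#|A| ^ (2 * m))%:R (2 * m) b1 C0 (ler0n _ _).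
  apply/negP; rewrite -leNgt.
  have n0 : (1 <= n)%N by exact: leq_ltn_trans mn.
  apply: le_trans (lb n n0 _ (generated_monotone_pulls Am (ltnW mn) Dm)) _.
  by rewrite -natrX -natrM ler_nat [leqRHS]mulnC card_monotone_pulls.
exists 2, (2 ^- (2 * #|A|)); split; first by rewrite ltr1n.
  by rewrite invr_gt0 exprn_gt0.
move=> n _ X XT; rewrite mulrC ler_pdivrMr ?exprn_gt0 //.
by rewrite -!natrX -natrM ler_nat card_generators_exp.
Qed.
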